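(* Fix an integer $t\ge 2$ and set $\lambda=\langle n,n-t,n-2t,n-3t\rangle$. Then there exists $N(t)$ such that for all integers $n\ge N(t)$ the rank-generating function $F_{\lambda}(q)$ is not unimodal.
   Context: For a partition with distinct parts $\lambda=\langle \lambda_1,\dots,\lambda_b\rangle$ (so $\lambda_1>\lambda_2>\dots>\lambda_b\ge 1$), a partition $\mu$ is contained in the shifted Ferrers shape $\lambda$ if $\mu=\langle\mu_1,\dots,\mu_k\rangle$ has distinct parts, $k\le b$, and $\mu_i\le\lambda_i$ for all $i\le k$ (the empty partition is included). The rank-generating function is $F_{\lambda}(q)=\sum_{\mu} q^{|\mu|}$, the sum over all such $\mu$, where $|\mu|$ is the sum of the parts of $\mu$. A polynomial $\sum_i c_iq^i$ is unimodal if there is an index $m$ with $c_0\le c_1\le\dots\le c_m\ge c_{m+1}\ge\dots$. *)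

(* Defs.v *)
From mathcomp Require Import all_boot all_order all_algebra.

Set Implicit Arguments.
Unset Strict Implicit.
Unset Printing Implicit Defensive.

Import Order.TTheory GRing.Theory Num.Theory.

(* Partitions are the sequences of their parts in decreasing order; the empty
   partition is [::]. *)
Definition is_strict_partition (mu : seq nat) : bool :=
  sorted gtn mu && all (fun x => 0 < x) mu.

Definition in_shifted_shape (la mu : seq nat) : bool :=
  [&& is_strict_partition mu, size mu <= size la &
      all (fun i => nth 0 mu i <= nth 0 la i) (iota 0 (size mu))].

Local Open Scope ring_scope.

(* The partitions contained in la have at most size la parts, each at most the
   first part of la, so they are enumerated by length k and then as k-tuples
   over 'I_(head 0 la).+1 (see rank_genfunE). *)
Definition rank_genfun (la : seq nat) : {poly int} :=
  \sum_(k < (size la).+1)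
    \sum_(mu : k.-tuple 'I_(head 0%N la).+1 | in_shifted_shape la (map val mu))
      'X^(sumn (map val mu)).

Definition unimodal (p : {poly int}) : Prop :=
  exists m : nat,
    (forall i : nat, (i < m)%N -> p`_i <= p`_i.+1) /\
    (forall i : nat, (m <= i)%N -> p`_i.+1 <= p`_i).

Lemma in_shifted_shape_le_head (la mu : seq nat) (x : nat) :
  in_shifted_shape la mu -> x \in mu -> (x <= head 0%N la)%N.
Proof.
case: mu => [|y mu] //= /and3P[/andP[/= smu _] _ /andP[le_y _]].
rewrite -nth0 inE => /predU1P[-> // | xmu].
apply: leq_trans le_y; apply: ltnW.
have gtn_trans : transitive gtn by move=> a b c /= ab ca; apply: ltn_trans ca ab.
by move: smu; rewrite (path_sortedE gtn_trans) => /andP[/allP/(_ x xmu)].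
Qed.

(* Any duplicate-free list of all the partitions contained in la gives
   rank_genfun la. *)
Lemma rank_genfunE (la : seq nat) (s : seq (seq nat)) :
  uniq s -> (forall mu, (mu \in s) = in_shifted_shape la mu) ->
  rank_genfun la = \sum_(mu <- s) 'X^(sumn mu).
Proof.
move=> s_uniq sE; rewrite /rank_genfun.
pose B := (head 0%N la).+1.
pose e (k : nat) : seq (seq nat) :=
  [seq map val (tval mu) | mu : k.-tuple 'I_B <- [seq mu : k.-tuple 'I_B <- enum {: k.-tuple 'I_B}
                                 | in_shifted_shape la (map val (tval mu))]].
have vi : injective (map (val : 'I_B -> nat)) by apply: inj_map; apply: val_inj.
have memE k mu : (mu \in e k) = in_shifted_shape la mu && (size mu == k).
  apply/mapP/andP => [[v] | [mu_in /eqP sz]].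
    by rewrite mem_filter => /andP[v_in _] ->; rewrite size_map size_tuple eqxx.
  have sz' : size (map (inord : nat -> 'I_B) mu) == k by rewrite size_map sz.
  have mapK : map val (map (inord : nat -> 'I_B) mu) = mu.
    rewrite -map_comp -[RHS]map_id; apply/eq_in_map => x x_mu /=.
    by rewrite inordK // ltnS; apply: in_shifted_shape_le_head x_mu.
  exists (Tuple sz'); last by rewrite /= mapK.
  by rewrite mem_filter [map val _]mapK mu_in mem_enum.
have e_uniq k : uniq (e k).
  rewrite map_inj_uniq; first exact/filter_uniq/enum_uniq.
  by move=> u v /vi; apply: val_inj.
pose f (mu : seq nat) : 'I_(size la).+1 := inord (size mu).
rewrite (partition_big f xpredT) //=; apply: eq_bigr => k _.
have -> : \sum_(mu : k.-tuple 'I_B | in_shifted_shape la (map val mu))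
    'X^(sumn (map val mu)) = \sum_(mu <- e k) 'X^(sumn mu) :> {poly int}.
  by rewrite big_map big_filter big_enum_cond.
rewrite -[RHS]big_filter; apply: perm_big; apply: uniq_perm => //.
  exact: filter_uniq.
move=> mu; rewrite memE mem_filter sE andbC.
case mu_in: (in_shifted_shape la mu); rewrite ?andbF ?andbT //.
by rewrite -val_eqE /= inordK // ltnS; case/and3P: mu_in.
Qed.

(* Main.v *)
(* For large n the coefficient of q^(2n-1) is a strict local minimum. Partitions of
   2n - 1 inside the shape inject, but not onto, those of 2n - 2 and those of 2n:
   one lowers, resp. raises, the first part, and uses an explicit map on the
   partitions where this breaks strictness, resp. the bound n. *)
Require Import Defs.
From mathcomp Require Import all_boot all_order all_algebra.
From mathcomp Require Import zify.

Set Implicit Arguments.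
Unset Strict Implicit.
Unset Printing Implicit Defensive.

Import Order.TTheory GRing.Theory Num.Theory.

(** * Coefficients as numbers of partitions, compared through injections *)

Fixpoint bounded_seqs (B k : nat) : seq (seq nat) :=
  if k is k'.+1 then
    [::] :: [seq x :: mu | x <- iota 0 B, mu <- bounded_seqs B k']
  else [:: [::]].

Lemma mem_bounded_seqs B k mu :
  size mu <= k -> all (fun x => x < B) mu -> mu \in bounded_seqs B k.
Proof.
elim: k mu => [|k IHk] [|x mu] //= sz /andP[xB muB].
rewrite inE /=; apply/allpairsP; exists (x, mu).
by rewrite mem_iota; split=> //; apply: IHk.
Qed.

Definition shape_seqs (la : seq nat) : seq (seq nat) :=
  undup [seq mu <- bounded_seqs (head 0 la).+1 (size la) | in_shifted_shape la mu].

Lemma mem_shape_seqs la mu : (mu \in shape_seqs la) = in_shifted_shape la mu.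
Proof.
rewrite mem_undup mem_filter; case: (boolP (in_shifted_shape la mu)) => //= mu_in.
apply: mem_bounded_seqs; first by case/and3P: mu_in.
by apply/allP => x xmu; rewrite ltnS; apply: in_shifted_shape_le_head xmu.
Qed.

Lemma coef_rank_genfun la s :
  ((rank_genfun la)`_s = (size [seq mu <- shape_seqs la | sumn mu == s])%:R)%R.
Proof.
rewrite (rank_genfunE (undup_uniq _) (mem_shape_seqs la)) coef_sum.
rewrite size_filter -sum1_count natr_sum [RHS]big_mkcond /=.
by apply: eq_bigr => mu _; rewrite coefXn eq_sym; case: eqP.
Qed.

(** The partition [nu] is missed by the injection [f]; putting it in front of the image of [f] keeps
    the list duplicate-free, which makes the inequality strict. *)
Lemma coef_rank_genfun_lt la s s' (f : seq nat -> seq nat) (nu : seq nat) :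
  (forall mu, in_shifted_shape la mu -> sumn mu = s ->
     [/\ in_shifted_shape la (f mu), sumn (f mu) = s' & f mu != nu]) ->
  (forall mu mu', in_shifted_shape la mu -> sumn mu = s ->
     in_shifted_shape la mu' -> sumn mu' = s -> f mu = f mu' -> mu = mu') ->
  in_shifted_shape la nu -> sumn nu = s' ->
  ((rank_genfun la)`_s < (rank_genfun la)`_s')%R.
Proof.
move=> f_in f_inj nu_in nu_s; rewrite !coef_rank_genfun ltr_nat.
set A := filter _ _; set B := filter _ _.
have memA mu : mu \in A -> in_shifted_shape la mu /\ sumn mu = s.
  by rewrite mem_filter mem_shape_seqs => /andP[/eqP].
rewrite -(size_map f A) -/(size (nu :: map f A)).
apply: uniq_leq_size.
  rewrite /= map_inj_in_uniq ?filter_uniq ?undup_uniq ?andbT //.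
    by apply/mapP => -[mu /memA[mu_in /(f_in _ mu_in)[_ _ /eqP]]] + /esym.
  by move=> mu mu' /memA[? ?] /memA[? ?]; apply: f_inj.
move=> mu; rewrite inE mem_filter mem_shape_seqs.
case/predU1P=> [->|/mapP[mu' /memA[m_in ms] ->]]; first by rewrite nu_s eqxx.
by case: (f_in _ m_in ms) => -> -> _; rewrite eqxx.
Qed.

(** * Partitions with at most four parts as quadruples *)

Definition parts4 (a b c d : nat) : seq nat := [seq x <- [:: a; b; c; d] | 0 < x].

(** Missing parts are zeros at the end of the quadruple; the [== 0] alternatives permit equal
    neighbours only inside this padding. *)
Definition fits4 (l1 l2 l3 l4 a b c d : nat) : bool :=
  [&& (b < a) || (a + b == 0), (c < b) || (b + c == 0), (d < c) || (c + d == 0),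
      a <= l1, b <= l2, c <= l3 & d <= l4].

Section FourRows.
Variables l1 l2 l3 l4 : nat.
Let la := [:: l1; l2; l3; l4].
Let fits := fits4 l1 l2 l3 l4.

Lemma parts4_in_shape a b c d :
  fits a b c d -> in_shifted_shape la (parts4 a b c d).
Proof.
rewrite /fits /fits4 /parts4 /in_shifted_shape /is_strict_partition.
by case: a b c d => [|a] [|b] [|c] [|d] //= H; lia.
Qed.

(** The default value 0 of [nth] supplies the padding. *)
Lemma in_shape_parts4 mu : in_shifted_shape la mu ->
  mu = parts4 (nth 0 mu 0) (nth 0 mu 1) (nth 0 mu 2) (nth 0 mu 3) /\
  fits (nth 0 mu 0) (nth 0 mu 1) (nth 0 mu 2) (nth 0 mu 3).
Proof.
rewrite /fits /fits4 /parts4 /in_shifted_shape /is_strict_partition.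
case: mu => [|a [|b [|c [|d [|e mu]]]]] //= H; last by lia.
- by case: a H => [|a] //= H; split=> //; lia.
- by case: a b H => [|a] [|b] //= H; (split=> //; lia) || lia.
- by case: a b c H => [|a] [|b] [|c] //= H; (split=> //; lia) || lia.
- by case: a b c d H => [|a] [|b] [|c] [|d] //= H; (split=> //; lia) || lia.
Qed.

Lemma sumn_parts4 a b c d : sumn (parts4 a b c d) = a + b + c + d.
Proof. by case: a b c d => [|a] [|b] [|c] [|d] /=; lia. Qed.

Lemma parts4_inj a b c d a' b' c' d' :
  fits a b c d -> fits a' b' c' d' ->
  parts4 a b c d = parts4 a' b' c' d' -> (a, b, c, d) = (a', b', c', d').
Proof.
have nthP x y z w : fits x y z w ->
    [/\ nth 0 (parts4 x y z w) 0 = x, nth 0 (parts4 x y z w) 1 = y,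
        nth 0 (parts4 x y z w) 2 = z & nth 0 (parts4 x y z w) 3 = w].
  by rewrite /fits /fits4; case: x y z w => [|x] [|y] [|z] [|w] //= H; lia.
move=> /nthP[e0 e1 e2 e3] /nthP[e0' e1' e2' e3'] eq_parts.
rewrite eq_parts in e0 e1 e2 e3.
by rewrite -e0 e0' -e1 e1' -e2 e2' -e3 e3'.
Qed.

(** On quadruples, membership in the shape and the size become linear conditions, so an injection
    [g] can be checked by arithmetic. *)
Lemma coef4_lt s s' (g : nat -> nat -> nat -> nat -> nat * nat * nat * nat)
    (p q r z : nat) :
  (forall a b c d, fits a b c d -> a + b + c + d = s ->
     let: (a', b', c', d') := g a b c d in
     [/\ fits a' b' c' d', a' + b' + c' + d' = s' &
         (a', b', c', d') <> (p, q, r, z)]) ->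
  (forall a b c d a' b' c' d', fits a b c d -> a + b + c + d = s ->
     fits a' b' c' d' -> a' + b' + c' + d' = s ->
     g a b c d = g a' b' c' d' -> (a, b, c, d) = (a', b', c', d')) ->
  fits p q r z -> p + q + r + z = s' ->
  ((rank_genfun la)`_s < (rank_genfun la)`_s')%R.
Proof.
move=> g_in g_inj nu_in nu_s.
pose f mu := let: (a, b, c, d) :=
  g (nth 0 mu 0) (nth 0 mu 1) (nth 0 mu 2) (nth 0 mu 3) in parts4 a b c d.
apply: (@coef_rank_genfun_lt la s s' f (parts4 p q r z)).
- move=> mu /in_shape_parts4[mu_def mu_in] mu_s.
  rewrite mu_def sumn_parts4 in mu_s.
  have := g_in _ _ _ _ mu_in mu_s.
  rewrite /f; case: (g _ _ _ _) => [[[a b] c] d] [g1 g2 g3].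
  rewrite sumn_parts4; split=> //; first exact: parts4_in_shape.
  by apply/eqP => /(parts4_inj g1 nu_in).
- move=> mu mu' /in_shape_parts4[mu_def mu_in] mu_s.
  move=> /in_shape_parts4[mu'_def mu'_in] mu'_s.
  rewrite mu_def sumn_parts4 in mu_s; rewrite mu'_def sumn_parts4 in mu'_s.
  have := g_in _ _ _ _ mu_in mu_s; have := g_in _ _ _ _ mu'_in mu'_s.
  have := @g_inj _ _ _ _ _ _ _ _ mu_in mu_s mu'_in mu'_s.
  rewrite /f; case: (g _ _ _ _) => [[[a b] c] d].
  case: (g _ _ _ _) => [[[a' b'] c'] d'] inj [g1' _ _] [g1 _ _].
  move=> /(parts4_inj g1 g1')inj'; case: (inj inj') => e0 e1 e2 e3.
  by rewrite mu_def mu'_def e0 e1 e2 e3.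
- exact: parts4_in_shape.
- by rewrite sumn_parts4.
Qed.

End FourRows.

(** * The strict local minimum at exponent 2n - 1 *)

Section Valley.
Variables n l2 l3 l4 t : nat.
Hypotheses (t_ge2 : 2 <= t) (n_l2 : l2 + t = n) (n_l3 : l3 + 2 * t = n).
Hypothesis n_l4 : l4 + 3 * t = n.
Let la := [:: n; l2; l3; l4].

(** A total of [2 * n - 1] exceeds the largest first part [n], so [b] is positive and the padding
    alternatives for the first two comparisons disappear. *)
Lemma fits4_middle a b c d : 6 * t <= n ->
  fits4 n l2 l3 l4 a b c d -> a + b + c + d = 2 * n - 1 ->
  [/\ b < a, c < b & (d < c) || (c + d == 0)] /\
  [/\ a <= n, b <= l2, c <= l3 & d <= l4].
Proof.
move=> n_ge; rewrite /fits4 => /and5P[ba cb dc an /and3P[bl -> ->]] s.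
by rewrite an bl dc; split; split=> //; lia.
Qed.

(* Lowering the first part fails on the partitions (x + 1, x, y, z) with
   2x + y + z = 2n - 2; then y + z = 2w and y - z = 2u, and the second branch of g
   is a partition since w + u < x. *)
Lemma coef_valley_left : 6 * t <= n ->
  ((rank_genfun la)`_(2 * n - 1) < (rank_genfun la)`_(2 * n - 2))%R.
Proof.
move=> n_ge.
(* The first part [n] marks the second branch, since the first one leaves at most [n - 1]. *)
pose g a b c d := if b.+1 < a then (a.-1, b, c, d) else
  (n, b - (c - d)./2, (c + d)./2, (c - d)./2.-1).
(* With [a = b.+1] the sum [c + d] is even, so both halves are exact; [d < c] makes [(c - d)./2]
   positive, and [u] is its predecessor. *)
have special a b c d : fits4 n l2 l3 l4 a b c d ->
    a + b + c + d = 2 * n - 1 -> (b.+1 < a) = false ->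
    exists u w, [/\ u < w.+1, c = w + u.+1, d + u.+1 = w, w + u.+1 < b & a = b.+1] /\
    [/\ b + w + 1 = n, b <= l2, (c + d)./2 = w & (c - d)./2 = u.+1].
  move=> H s ab; have [[ba cb dc] [_ bl cl dl]] := fits4_middle n_ge H s.
  have {H}ea : a = b.+1 by lia.
  have {}dc : d < c by lia.
  have even_cd : (c + d)./2 + (c + d)./2 = c + d by lia.
  have even_cBd : (c - d)./2 + (c - d)./2 = c - d by lia.
  exists (c - d)./2.-1, (c + d)./2.
  have : 0 < (c - d)./2 by lia.
  move: (c + d)./2 (c - d)./2 even_cd even_cBd => w [|u] //= ew eu _.
  by do 2!split=> //; lia.
(* The missed partition has first part [n], excluding the first branch, and second part [l2],
   excluding the second, where [b <= l2] is lowered by at least 1. *)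
apply: (@coef4_lt _ _ _ _ _ _ g n l2 (t - 2) 0).
- move=> a b c d H s; rewrite /g; case: ifP => ab.
    have [[ba cb dc] [an bl cl dl]] := fits4_middle n_ge H s.
    split; [|lia|case; lia].
    by rewrite /fits4 dc bl cl dl; lia.
  have [u [w [[uw ec ed wub ea] [bwn bl -> ->]]]] := special a b c d H s ab.
  clear H s ab; rewrite /= /fits4; split.
  + have {}wub : w < b - u.+1 by lia.
    have -> : w <= l3 by lia.
    by lia.
  + by lia.
  + by case; lia.
- move=> a b c d a' b' c' d' H s H' s'.
  have [[ba cb _] [an _ _ _]] := fits4_middle n_ge H s.
  have [[ba' cb' _] [an' _ _ _]] := fits4_middle n_ge H' s'.
  rewrite /g; case: ifP => ab; case: ifP => ab'.
  + by case=> ea -> -> ->; have -> : a = a' by lia.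
  + by clear - an ab; case=> *; lia.
  + by clear - an' ab'; case=> *; lia.
  have [u [w [[_ ec ed _ ea] [bwn _ -> ->]]]] := special a b c d H s ab.
  have [u' [w' [[_ ec' ed' _ ea'] [bwn' _ -> ->]]]] := special _ _ _ _ H' s' ab'.
  case=> _ ew eu; clear - ec ed ea bwn ec' ed' ea' bwn' ew eu.
  have eb : b = b' by lia.
  have ed2 : d = d' by lia.
  by rewrite ea ea' ec ec' eb ed2 ew eu.
- by rewrite /fits4; lia.
- by lia.
Qed.

(* Raising the first part fails on the partitions with mu_1 = n. Those with
   mu_3 >= t are handled by the second branch of g; the boundedly many others go to
   (y + 2, y + 1, y, 2n - 3 - 3y), of which there are about n / 6. *)
Lemma coef_valley_right : 12 * (t * t) + 12 <= n ->
  ((rank_genfun la)`_(2 * n - 1) < (rank_genfun la)`_(2 * n))%R.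
Proof.
have tt : 2 * t <= t * t by rewrite leq_mul2r t_ge2 orbT.
(* The code numbers the pairs [(c, d)] left to the last branch; there [a = n], and the total then
   fixes [b]. *)
have [code code_lt code_inj] : exists2 code : nat -> nat -> nat,
    forall c d, c < t -> d < t -> code c d < t * t &
    forall c d c' d', d < t -> d' < t -> code c d = code c' d' -> c = c' /\ d = d'.
  exists (fun c d => c * t + d) => [c d ct dt | c d c' d' dt dt' e].
    apply: (@leq_trans (c.+1 * t)); first by rewrite mulSn; lia.
    by rewrite leq_mul2r ct orbT.
  have t0 : 0 < t by lia.
  have := congr1 (divn^~ t) e; have := congr1 (modn^~ t) e.
  by rewrite /= !modnMDl !divnMDl // !modn_small // !divn_small // !addn0.
(* Making [t * t] opaque leaves only linear arithmetic. *)
move: (t * t) tt code_lt => T tt code_lt n_ge.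
have {}n_ge6 : 6 * t <= n by lia.
(* [y0] is the least [y] for which the last part [2 * n - 3 - 3 * y] is below [y]. *)
have [y0 y0_lo y0_hi] : exists2 y0, 2 * n - 3 < 4 * y0 & 4 * y0 <= 2 * n + 1.
  by exists ((2 * n - 3) %/ 4 + 1); lia.
pose z k := 2 * n - 3 - 3 * (y0 + k).
have stairP k : k <= T -> fits4 n l2 l3 l4 (y0 + k).+2 (y0 + k).+1 (y0 + k) (z k) /\
    (y0 + k).+2 + (y0 + k).+1 + (y0 + k) + z k = 2 * n.
  move=> kT; have zE : z k + 3 * (y0 + k) + 3 = 2 * n by rewrite /z; lia.
  split; last by lia.
  have yz : z k < y0 + k by lia.
  have yl : y0 + k <= l3 by lia.
  by rewrite /fits4 !ltnS !leqnn yz yl /=; lia.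
(* Gaps separate the branches: the first two parts differ by at least 2 in the first branch and by 1
   in the others; the second and third differ by [b.+1 - c], at least 2, in the second branch and by
   1 in the last. In the second branch [(b + d).+1 = n - c], so [t <= c] keeps it within [l2]. *)
pose g a b c d := if a < n then (a.+1, b, c, d) else
  if t <= c then ((b + d).+2, (b + d).+1, c + d, c.-1 - d)
  else let k := code c d in ((y0 + k).+2, (y0 + k).+1, y0 + k, z k).
(* Codes stay below [T], so the staircase with index [T] is missed. *)
apply: (@coef4_lt _ _ _ _ _ _ g (y0 + T).+2 (y0 + T).+1 (y0 + T) (z T)).
- move=> a b c d H s; rewrite /g.
  have [[ba cb dc] [an bl cl dl]] := fits4_middle n_ge6 H s; clear H.
  case: ifP => ltan.
    split; [|lia|case; lia].
    by rewrite /fits4 dc bl cl dl ltan cb ltnS ltnW.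
  case: ifP => ct.
    have {}dc : d < c by lia.
    have [e ec] : exists e, c = (d + e).+1 by exists (c.-1 - d); lia.
    have -> : c.-1 - d = e by lia.
    split; [|lia|case; lia].
    by rewrite /fits4; clear - ec s ct an ltan cb n_l2 n_l3 n_l4 n_ge6; lia.
  have k_lt : code c d < T by apply: code_lt; lia.
  have [k_fits k_sum] := stairP _ (ltnW k_lt).
  by split=> //; case=> _; lia.
- move=> a b c d a' b' c' d' H s H' s'; rewrite /g.
  have [[ba cb dc] [an _ _ _]] := fits4_middle n_ge6 H s; clear H.
  have [[ba' cb' dc'] [an' _ _ _]] := fits4_middle n_ge6 H' s'; clear H'.
  case: (ltnP a n) => lan; case: (ltnP a' n) => lan'.
  + by case=> -> -> -> ->.
  + by case: (leqP t c') => ct; case=> *; lia.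
  + by case: (leqP t c) => ct; case=> *; lia.
  have ea : a = n by lia.
  have ea' : a' = n by lia.
  case: (leqP t c) => ct; case: (leqP t c') => ct'.
  + case=> _ e1 e2 e3.
    have ed : d = d' by clear - dc dc' ct ct' t_ge2 e2 e3; lia.
    by move: e1 e2; rewrite ed => /addIn-> /addIn->; rewrite ea ea'.
  + by case=> *; lia.
  + by case=> *; lia.
  have dt : d < t by lia.
  have dt' : d' < t by lia.
  case=> /addnI e _; have [ec ed] := code_inj _ _ _ _ dt dt' e.
  have eb : b = b' by lia.
  by rewrite ea ea' eb ec ed.
- by case: (stairP T).
- by case: (stairP T).
Qed.

End Valley.

Theorem theorem2p5 (t : nat) (ht : 2 <= t) :
  exists N : nat, forall n : nat, N <= n ->
    ~ unimodal (rank_genfun [:: n; n - t; n - 2 * t; n - 3 * t]).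
Proof.
(* This bound leaves room for the staircases with indices 0 to [t * t]. *)
exists (12 * (t * t) + 12) => n n_ge [m [up down]].
have tt : 2 * t <= t * t by rewrite leq_mul2r ht orbT.
have n_ge6 : 6 * t <= n by lia.
have [el2 el3 el4] : [/\ n - t + t = n, n - 2 * t + 2 * t = n & n - 3 * t + 3 * t = n].
  by split; lia.
have lt_l := coef_valley_left ht el2 el3 el4 n_ge6.
have lt_r := coef_valley_right ht el2 el3 el4 n_ge.
have e1 : 2 * n - 1 = (2 * n - 2).+1 by lia.
have e2 : 2 * n = (2 * n - 1).+1 by lia.
(* A peak beyond [2 * n - 2] contradicts the descent into [2 * n - 1]; any other peak contradicts
   the ascent out of it. *)
have [lt_m|le_m] := ltnP (2 * n - 2) m.
  by have := up _ lt_m; rewrite -e1 leNgt lt_l.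
have := down (2 * n - 1); rewrite -e2 leNgt lt_r; lia.
Qed.
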